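(* If $w$ is a cone vertex of a simplicial complex $\Lambda$, then $\Lambda=\operatorname{lk}_\Lambda(w)\ast w$. Consequently coning is injective on isomorphism classes: if $\Delta$ and $\Delta'$ are simplicial complexes and $v,v'$ are new vertices (not vertices of $\Delta$, respectively $\Delta'$) with $\Delta\ast v\cong\Delta'\ast v'$, then $\Delta\cong\Delta'$.
   Context: A simplicial complex on a finite vertex set $V$ is a collection of subsets of $V$ (faces) closed under taking subsets; it is assumed that $\{i\}$ is a face for every $i\in V$. Facets are the inclusion-maximal faces. A vertex is a cone vertex if it lies in every facet. For a vertex $v\notin V$, the cone is $\Delta\ast v=\Delta\cup\{S\cup\{v\}:S\in\Delta\}$, a simplicial complex on $V\cup\{v\}$. The link of a vertex $w$ is $\operatorname{lk}_\Lambda(w)=\{\tau\in\Lambda:w\notin\tau,\ \tau\cup\{w\}\in\Lambda\}$. $\cong$ denotes isomorphism of abstract simplicial complexes (a bijection of vertex sets carrying faces onto faces). *)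

(* Defs.v *)
From HB Require Import structures.
From mathcomp Require Import all_boot.

Set Implicit Arguments.
Unset Strict Implicit.
Unset Printing Implicit Defensive.

(* A vertex set together with a collection of faces.  The vertex set is a
   subset of an ambient finite type, so that there is room for the apex of a
   cone and so that a complex can be compared with the cone over a link.  The
   axioms of a simplicial complex are the separate predicate
   [simplicial_complex]. *)
Record set_system (T : finType) := SetSystem {
  vertices : {set T};
  faces : {set {set T}}
}.

(* The empty face is not required: it is automatic unless [vertices D] is
   empty, in which case both [set0] and [[set set0]] are allowed as
   [faces D]. *)
Definition simplicial_complex (T : finType) (D : set_system T) : Prop :=
  [/\ forall S, S \in faces D -> S \subset vertices D,
      forall S S' : {set T}, S \in faces D -> S' \subset S -> S' \in faces D
    & forall i, i \in vertices D -> [set i] \in faces D].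

Definition facet (T : finType) (D : set_system T) (F : {set T}) : bool :=
  maxset (fun S => S \in faces D) F.

Definition cone_vertex (T : finType) (D : set_system T) (w : T) : Prop :=
  w \in vertices D /\ forall F, facet D F -> w \in F.

Definition cone (T : finType) (D : set_system T) (v : T) : set_system T :=
  SetSystem (v |: vertices D)
            (faces D :|: [set v |: S | S in faces D]).

Definition link_faces (T : finType) (D : set_system T) (w : T) :
    {set {set T}} :=
  [set t in faces D | (w \notin t) && (w |: t \in faces D)].

(* The vertices of a link are the points whose singletons belong to it. *)
Definition link (T : finType) (D : set_system T) (w : T) : set_system T :=
  SetSystem [set i | [set i] \in link_faces D w] (link_faces D w).

(* The image of [S :&: vertices D] under a map of vertex sets. *)
Definition face_image (T T' : finType) (D : set_system T) (D' : set_system T')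
    (f : {x | x \in vertices D} -> {x | x \in vertices D'}) (S : {set T}) :
    {set T'} :=
  [set val (f x) | x in [set x | val x \in S]].

Definition isomorphic (T T' : finType)
    (D : set_system T) (D' : set_system T') : Prop :=
  exists2 f : {x | x \in vertices D} -> {x | x \in vertices D'},
    bijective f & [set face_image f S | S in faces D] = faces D'.

(* Main.v *)
Require Import Defs.
From HB Require Import structures.
From mathcomp Require Import all_boot perm.

Set Implicit Arguments.
Unset Strict Implicit.
Unset Printing Implicit Defensive.

(** Call a point [a] an apex of a collection of sets when adjoining [a] to a
    member gives a member again.  A cone vertex is an apex, because every face
    extends to a facet and every facet contains the cone vertex
    ([cone_vertex_apex]); hence the faces through [w] are exactly the faces of
    the link with [w] adjoined, which is the first claim.

    For the second claim, an isomorphism [f] of cones over [D] and [D'] need not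
    send the apex [v] to the apex [v'].  But [f v] is an apex too, since being
    an apex is preserved by isomorphisms ([apex_image]), and exchanging two
    apexes is an automorphism of a complex ([swap_apexes]).  Following [f] by
    the exchange of [f v] and [v'] gives an isomorphism of cones that sends [v]
    to [v'].  It restricts to [D], because [D] consists of the faces of the cone
    that avoid the apex ([cone_isomorphic_restrict]). *)

Definition apex (T : finType) (F : {set {set T}}) (a : T) : Prop :=
  forall S, S \in F -> a |: S \in F.

Definition down_closed (T : finType) (F : {set {set T}}) : Prop :=
  forall S S' : {set T}, S \in F -> S' \subset S -> S' \in F.

Lemma cone_vertex_apex (T : finType) (L : set_system T) (w : T) :
  simplicial_complex L -> cone_vertex L w -> apex (faces L) w.
Proof.
move=> [_ down _] [_ wF] S SL.
have [F maxF subSF] := maxset_exists (P := fun S => S \in faces L) SL.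
apply: (down F); first exact: maxsetp maxF.
by rewrite subUset sub1set wF.
Qed.

Lemma cone_link (T : finType) (L : set_system T) (w : T) :
  simplicial_complex L -> cone_vertex L w -> L = cone (link L w) w.
Proof.
move=> simpL coneL; have apw := cone_vertex_apex simpL coneL.
case: simpL coneL => subV down sing [wL _].
have linkE S : (S \in link_faces L w) = (S \in faces L) && (w \notin S).
  rewrite inE; case SL: (S \in faces L) => //=.
  by rewrite apw // andbT.
rewrite /cone /link /=; case: L subV down sing wL apw linkE => V F /=.
move=> subV down sing wL apw linkE; congr SetSystem.
- apply/setP => x; rewrite in_setU1 in_set linkE in_set1.
  have [-> | _] := eqVneq x w; first by rewrite wL.
  rewrite andbT /=; apply/idP/idP => [|xF]; first exact: sing.
  by have := subV _ xF; rewrite sub1set.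
- apply/setP => S; rewrite in_setU linkE.
  apply/idP/orP => [SF | [/andP[] // | /imsetP[R]]].
  + have [wS | _] := boolP (w \in S); last by left; rewrite SF.
    right; apply/imsetP; exists (S :\ w); last by rewrite setD1K.
    by rewrite linkE setD11 andbT (down S) // subsetDl.
  + by rewrite linkE => /andP[RF _] ->; apply: apw.
Qed.

Section Cone.

Variables (T : finType) (D : set_system T) (v : T).
Hypotheses (simpD : simplicial_complex D) (vD : v \notin vertices D).

Lemma mem_cone_apex : v \in vertices (cone D v).
Proof. exact: setU11. Qed.

Lemma mem_cone_base x : x \in vertices D -> x \in vertices (cone D v).
Proof. exact: setU1r. Qed.

Lemma face_notin_apex S : S \in faces D -> v \notin S.
Proof.
by case: simpD => subV _ _ /subV/subsetP subS; apply: contra vD; apply: subS.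
Qed.

Lemma faces_coneE S : (S \in faces (cone D v)) = (S :\ v \in faces D).
Proof.
have [_ down _] := simpD.
rewrite in_setU; apply/orP/idP => [[SD | /imsetP[R RD ->]] | SD].
- by apply: down SD (subsetDl _ _).
- by rewrite setU1K ?face_notin_apex.
have [vS | nvS] := boolP (v \in S).
  by right; apply/imsetP; exists (S :\ v); rewrite ?setD1K.
by left; move: SD; rewrite (setDidPl _) // disjoint_sym disjoints1.
Qed.

Lemma faces_baseE S :
  (S \in faces D) = (S \in faces (cone D v)) && (v \notin S).
Proof.
rewrite faces_coneE; have [vS | nvS] /= := boolP (v \in S).
  by rewrite andbF; apply/negP => /face_notin_apex; rewrite vS.
by rewrite andbT (setDidPl _) // disjoint_sym disjoints1.
Qed.

Lemma cone_apex : apex (faces (cone D v)) v.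
Proof. by move=> S; rewrite !faces_coneE setDUl setDv set0U. Qed.

Lemma cone_down_closed : down_closed (faces (cone D v)).
Proof.
have [_ down _] := simpD.
by move=> S R; rewrite !faces_coneE => SD RS; apply: down SD (setSD _ RS).
Qed.

Lemma cone_faces_sub S :
  S \in faces (cone D v) -> S \subset vertices (cone D v).
Proof.
by have [subV _ _] := simpD; rewrite faces_coneE => /subV; rewrite subDset.
Qed.

End Cone.

Section FaceImage.

Variables (T T' : finType) (L : set_system T) (L' : set_system T').
Variable f : {x | x \in vertices L} -> {x | x \in vertices L'}.
Implicit Types (a : {x | x \in vertices L}) (S : {set T}).

Lemma face_image_comp (T'' : finType) (L'' : set_system T'')
    (g : {x | x \in vertices L'} -> {x | x \in vertices L''}) S :
  face_image (g \o f) S = face_image g (face_image f S).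
Proof.
apply/setP => z; apply/imsetP/imsetP => [[x] | [y]].
  rewrite inE => xS ->; exists (f x) => //.
  by rewrite inE; apply/imsetP; exists x; rewrite ?inE.
rewrite inE => /imsetP[x xS /val_inj yE ->].
by exists x => //=; rewrite yE.
Qed.

Lemma face_imageU1 a S :
  face_image f (val a |: S) = val (f a) |: face_image f S.
Proof.
have imE : [set x | val x \in val a |: S] = a |: [set x | val x \in S].
  by apply/setP => x; rewrite !inE.
by rewrite /face_image imE imsetU1.
Qed.

Lemma mem_face_image a S :
  injective f -> (val (f a) \in face_image f S) = (val a \in S).
Proof. by move=> injf; rewrite (mem_imset _ _ (inj_comp val_inj injf)) inE. Qed.

Lemma apex_image a :
  [set face_image f S | S in faces L] = faces L' ->
  apex (faces L) (val a) -> apex (faces L') (val (f a)).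
Proof.
move=> <- apa _ /imsetP[S SL ->]; rewrite -face_imageU1.
by apply: imset_f; apply: apa.
Qed.

End FaceImage.

(** Exchanging [a] and [b] takes a face [S] to a subset of [a |: (b |: S)],
    which is a face as both points are apexes.  So the exchange maps faces to
    faces, and onto them because it is an involution. *)
Lemma swap_apexes (T : finType) (L : set_system T)
    (a b : {x | x \in vertices L}) :
  (forall S, S \in faces L -> S \subset vertices L) ->
  down_closed (faces L) ->
  apex (faces L) (val a) -> apex (faces L) (val b) ->
  [set face_image (tperm a b) S | S in faces L] = faces L.
Proof.
move=> subV down apa apb; set t := face_image (tperm a b).
have tL S : S \in faces L -> t S \in faces L.
  move=> SL; apply: down (apa _ (apb _ SL)) _.
  apply/subsetP => z /imsetP[x]; rewrite inE => xS ->.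
  by case: tpermP => _; rewrite !inE ?eqxx ?xS ?orbT.
have tK S : S \in faces L -> t (t S) = S.
  move=> SL; rewrite /t -face_image_comp; apply/setP => x.
  apply/imsetP/idP => [[y] | xS].
    by rewrite inE /= tpermK => yS ->.
  exists (Sub x (subsetP (subV _ SL) x xS)); rewrite ?inE ?SubK //=.
  by rewrite tpermK.
apply/setP => S; apply/imsetP/idP => [[R RL ->] | SL]; first exact: tL.
by exists (t S); [apply: tL | rewrite tK].
Qed.

(** [f] maps [vertices D] into [vertices D'] because it is injective and sends
    [v] to [v'].  A face of the cone avoids [v] exactly when its image avoids
    [v'], so [f] also matches the faces of [D] with those of [D']. *)
Lemma cone_isomorphic_restrict (T T' : finType)
    (D : set_system T) (D' : set_system T') (v : T) (v' : T')
    (f : {x | x \in vertices (cone D v)} ->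
         {x | x \in vertices (cone D' v')}) :
  simplicial_complex D -> simplicial_complex D' ->
  v \notin vertices D -> v' \notin vertices D' -> bijective f ->
  [set face_image f S | S in faces (cone D v)] = faces (cone D' v') ->
  val (f (Sub v (mem_cone_apex D v))) = v' -> isomorphic D D'.
Proof.
move=> simpD simpD' vD vD' bijf fF; set a := Sub v _ => fa.
have injf := bij_inj bijf.
have avoid x : val x != v -> val (f x) \in vertices D'.
  move=> xv; have := valP (f x); rewrite /= in_setU1 => /orP[/eqP fx | //].
  case/eqP: xv; suff -> : x = a by [].
  by apply: injf; apply: val_inj; rewrite /= fx fa.
pose i (x : {x | x \in vertices D}) : {x | x \in vertices (cone D v)} :=
  Sub (val x) (mem_cone_base v (valP x)).
have iv x : val (i x) != v by apply: contraNneq vD => <-; apply: (valP x).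
pose g x : {x | x \in vertices D'} := Sub (val (f (i x))) (avoid _ (iv x)).
have injg : injective g.
  by move=> x y [] /val_inj/injf[] /val_inj.
have gE (S : {set T}) : v \notin S -> face_image g S = face_image f S.
  move=> vS; apply/setP => z; apply/imsetP/imsetP => [[x] | [y]].
    by rewrite inE => xS ->; exists (i x); rewrite ?inE.
  rewrite inE => yS ->.
  have yD : val y \in vertices D.
    have := valP y; rewrite /= in_setU1 => /orP[/eqP yv | //].
    by case/negP: vS; rewrite -yv.
  exists (Sub (val y) yD); rewrite ?inE //=.
  by congr (val (f _)); apply: val_inj.
(* An injection between sets of equal size is bijective, and the two bases have
   one point less than their cones, which [f] shows to be of equal size. *)
have cardDD' : #|{: {x | x \in vertices D'}}| <= #|{: {x | x \in vertices D}}|.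
  by have := bij_eq_card bijf; rewrite !card_sig !cardsU1 vD vD' => /addnI ->.
exists g; first exact: inj_card_bij injg cardDD'.
have v'E (S : {set T}) : (v' \in face_image f S) = (v \in S).
  by have := mem_face_image a S injf; rewrite [val (f a)]fa.
apply/setP => S'; apply/imsetP/idP => [[S SD ->] | S'D'].
- move: SD; rewrite (faces_baseE simpD vD) => /andP[SC vS].
  by rewrite gE // (faces_baseE simpD' vD') v'E vS andbT -fF imset_f.
- move: S'D'; rewrite (faces_baseE simpD' vD') -fF => /andP[/imsetP[S SC ->]].
  rewrite v'E => vS; exists S; last by rewrite gE.
  by rewrite (faces_baseE simpD vD) SC.
Qed.

(** An isomorphism of cones becomes apex-preserving once it is followed by the
    exchange of the two apexes [f v] and [v'] of the target. *)
Lemma cone_isomorphic_inj (T T' : finType)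
    (D : set_system T) (D' : set_system T') (v : T) (v' : T') :
  simplicial_complex D -> simplicial_complex D' ->
  v \notin vertices D -> v' \notin vertices D' ->
  isomorphic (cone D v) (cone D' v') -> isomorphic D D'.
Proof.
move=> simpD simpD' vD vD' [f bijf fF].
pose a : {x | x \in vertices (cone D v)} := Sub v (mem_cone_apex D v).
pose a' : {x | x \in vertices (cone D' v')} := Sub v' (mem_cone_apex D' v').
have apfa : apex (faces (cone D' v')) (val (f a)).
  by apply: apex_image fF _; apply: cone_apex.
have swapF : [set face_image (tperm (f a) a') S | S in faces (cone D' v')]
             = faces (cone D' v').
  apply: swap_apexes apfa _; last exact: cone_apex.
  - by move=> S; apply: cone_faces_sub.
  - exact: cone_down_closed.
apply: (@cone_isomorphic_restrict _ _ _ _ _ _ (tperm (f a) a' \o f)) => //.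
- by apply: bij_comp => //; exists (tperm (f a) a'); apply: tpermK.
- rewrite -[RHS]swapF -fF -imset_comp; apply: eq_imset => S.
  exact: face_image_comp.
- by rewrite /= tpermL.
Qed.

Theorem lemma2p15 :
  (forall (T : finType) (L : set_system T) (w : T),
     simplicial_complex L -> cone_vertex L w -> L = cone (link L w) w) /\
  (forall (T T' : finType) (D : set_system T) (D' : set_system T')
          (v : T) (v' : T'),
     simplicial_complex D -> simplicial_complex D' ->
     v \notin vertices D -> v' \notin vertices D' ->
     isomorphic (cone D v) (cone D' v') -> isomorphic D D').
Proof. by split; [exact: cone_link | exact: cone_isomorphic_inj]. Qed.
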